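(* Let $\varepsilon\in(0,1)$ and set $k=0$ and $\varphi=\frac{\varepsilon}{1-\varepsilon}$. Let $G=(V,E)$ be any graph, and suppose its edges are inserted, starting from the empty graph $(V,\emptyset)$, in the order of a permutation of $E$ chosen uniformly at random, and processed by $\textsc{Lazy-Alg}(\varphi,k)$. Then at every time step $t\le|E|$ (all quantities referring to the graph $G^{(t)}$ formed by the first $t$ inserted edges): for every vertex $v$, $\widetilde{\mathcal{B}}_2(v)\subseteq\mathcal{B}_2(v)$ and $\mathbb{E}[|\widetilde{\mathcal{B}}_2(v)|]\ge(1-\varepsilon)|\mathcal{B}_2(v)|$ (i.e. the algorithm has approximation ratio $\frac{1}{1-\varepsilon}$). Moreover, for every $\alpha>0$ and every vertex $v\in V$, $$\Pr\left[|\widetilde{\mathcal{B}}_2(v)|<\frac{1-\alpha}{1+\varphi}|L_2(v)|\right]\le e^{-\frac{2\alpha^2|L_2(v)|}{(1+\varphi)^2}}.$$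
   Context: For a vertex $x$ of the current graph, $N(x)$ is its neighborhood, $\deg_x=|N(x)|$, $\mathcal{B}_1(x)=N(x)\cup\{x\}$, $\mathcal{B}_2(x)$ is the set of vertices at distance at most $2$ from $x$, and $L_2(x)$ is the set of vertices at distance exactly $2$ from $x$. Expectations and probabilities are over the random permutation (and any randomness of the algorithm). Algorithm $\textsc{Lazy-Alg}(\varphi,k)$ (with $\varphi\ge 0$, integer $k\ge 0$): each vertex $x$ stores sets $\widetilde{\mathcal{B}}_1(x)$, $\widetilde{\mathcal{B}}_2(x)$ and counters $\delta_x,\Delta_x$. Initialization on the initial graph: $\delta_x=0$, $\Delta_x=\deg_x$, $\widetilde{\mathcal{B}}_1(x)=\mathcal{B}_1(x)$, $\widetilde{\mathcal{B}}_2(x)=\mathcal{B}_2(x)$. On insertion of edge $(u,v)$ (added to the graph), for $x=u$ and then $x=v$, with $y$ the other endpoint: (1) $\widetilde{\mathcal{B}}_1(x)\gets\widetilde{\mathcal{B}}_1(x)\cup\{y\}$; (2) $\widetilde{\mathcal{B}}_2(x)\gets\widetilde{\mathcal{B}}_2(x)\cup\widetilde{\mathcal{B}}_1(y)$; (3) $\delta_x\gets\delta_x+1$; (4) if $\delta_x\ge\varphi\Delta_x$, set $\Delta_x\gets\Delta_x+\delta_x$, $\delta_x\gets0$, and for every $z\in N(x)$ do $\widetilde{\mathcal{B}}_2(z)\gets\widetilde{\mathcal{B}}_2(z)\cup\widetilde{\mathcal{B}}_1(x)$; otherwise select $k$ vertices $w_1,\dots,w_k\in N(x)$ uniformly at random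 and do $\widetilde{\mathcal{B}}_2(w_i)\gets\widetilde{\mathcal{B}}_2(w_i)\cup\widetilde{\mathcal{B}}_1(x)$ for each $i$. *)

(* Defs.v *)
From mathcomp Require Import all_boot all_order all_fingroup all_algebra.
From mathcomp Require Import reals.

Set Implicit Arguments.
Unset Strict Implicit.
Unset Printing Implicit Defensive.

Local Open Scope ring_scope.

(* A finite simple graph on V is given by its edge set, a set of 2-subsets. *)
Section Graph.
Variable V : finType.
Implicit Type E : {set {set V}}.

Definition simple_graph E := forall e, e \in E -> #|e| = 2%N.

Definition adj E : rel V := fun x y => [set x; y] \in E.

Definition nbhd E x : {set V} := [set y | adj E x y].

Definition dist_le E n x y : bool :=
  [exists m : 'I_n.+1, [exists p : m.-tuple V, path (adj E) x p && (last x p == y)]].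

Definition ball1 E x : {set V} := x |: nbhd E x.
Definition ball2 E x : {set V} := [set y | dist_le E 2 x y].
Definition layer2 E x : {set V} := [set y | dist_le E 2 x y && ~~ dist_le E 1 x y].

(* [orient e] lists the endpoints of the edge [e] in the order in which the
   algorithm handles them when [e] is inserted. *)
Definition orientation E (orient : {set V} -> V * V) :=
  forall e, e \in E -> e = [set (orient e).1; (orient e).2].

End Graph.

Section LazyAlg.
Variables (R : realType) (V : finType).

Record state := State {
  tB1 : V -> {set V};
  tB2 : V -> {set V};
  delta : V -> nat;
  Delta : V -> nat }.

Definition init (g : {set {set V}}) : state :=
  State (ball1 g) (ball2 g) (fun=> 0%N) (fun x => #|nbhd g x|).

Definition upd (T : Type) (f : V -> T) (x : V) (a : T) : V -> T :=
  fun z => if z == x then a else f z.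

(* When [p] is a uniform permutation of V, the first element of N(x) in the
   order that [p] induces on V is a uniform element of N(x). *)
Definition random_nbr (g : {set {set V}}) (x : V) (p : {perm V}) : option V :=
  ohead [seq z <- [seq p z | z <- enum V] | z \in nbhd g x].

Variables (phi : R) (k : nat).

(* [g] already contains the inserted edge {x, y}; [w] is the randomness used
   to draw the k vertices, independently, in the light case. *)
Definition process (g : {set {set V}}) (w : 'I_k -> {perm V}) (x y : V)
    (s : state) : state :=
  let b1 := upd (tB1 s) x (tB1 s x :|: [set y]) in
  let b2 := upd (tB2 s) x (tB2 s x :|: b1 y) in
  let d := (delta s x).+1 in
  if phi * (Delta s x)%:R <= d%:R then
    State b1 (fun z => if z \in nbhd g x then b2 z :|: b1 x else b2 z)
      (upd (delta s) x 0%N) (upd (Delta s) x (Delta s x + d)%N)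
  else
    State b1
      (fun z => if [exists i, random_nbr g x (w i) == Some z]
                then b2 z :|: b1 x else b2 z)
      (upd (delta s) x d) (Delta s).

Definition insert (g : {set {set V}}) (w : bool -> 'I_k -> {perm V})
    (uv : V * V) (s : state) : state :=
  process g (w true) uv.2 uv.1 (process g (w false) uv.1 uv.2 s).

End LazyAlg.

(* Outcomes: a permutation giving the insertion order of the edges, and the
   random bits of the algorithm, indexed by time step, endpoint and draw. *)
Definition outcome (V : finType) (E : {set {set V}}) (k : nat) : finType :=
  ('S_#|E| * {ffun 'I_#|E| * bool * 'I_k -> {perm V}})%type.

Section Run.
Variables (R : realType) (V : finType) (E : {set {set V}}).
Variables (orient : {set V} -> V * V) (phi : R) (k : nat).
Implicit Type w : outcome E k.

Definition edge_at w (i : 'I_#|E|) : {set V} := enum_val (w.1 i).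

Definition graph_at (t : nat) w : {set {set V}} :=
  [set edge_at w i | i : 'I_#|E| & (i < t)%N].

Definition lazy_alg (t : nat) w : state V :=
  foldl (fun s (i : 'I_#|E|) =>
           insert phi (graph_at i.+1 w) (fun b j => w.2 (i, b, j))
             (orient (edge_at w i)) s)
    (init set0) (take t (enum 'I_#|E|)).

End Run.

(* Conditional expectation and probability given the random variable Y, for
   the uniform distribution on a finite sample space, at the outcome w0. *)
Definition cond_expect (R : realType) (W : finType) (T : eqType)
    (Y : W -> T) (X : W -> R) (w0 : W) : R :=
  (\sum_(w | Y w == Y w0) X w) / #|[set w | Y w == Y w0]|%:R.

Definition cond_prob (R : realType) (W : finType) (T : eqType)
    (Y : W -> T) (A : pred W) (w0 : W) : R :=
  #|[set w | (Y w == Y w0) && A w]|%:R / #|[set w | Y w == Y w0]|%:R.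

(* Main.v *)
Require Import Defs.
From mathcomp Require Import all_boot all_order all_fingroup all_algebra.
From mathcomp Require Import reals sequences exp.
From mathcomp Require Import ring lra zify.
From mathcomp Require interval normedtype derive realfun.

Set Implicit Arguments.
Unset Strict Implicit.
Unset Printing Implicit Defensive.

Import Order.TTheory GRing.Theory Num.Theory.

Local Open Scope ring_scope.

(* Fix the graph H formed by the first t edges.  The counter Delta of a vertex x
   depends only on its degree d and satisfies Delta >= (1 - eps) d.  A vertex u
   at distance 2 from v, with a chosen common neighbour x, can be missing from
   the approximate 2-ball of v only if the edge xu (a "spoke" at x) is not among
   the first Delta edges at x; by symmetry this has probability at most eps,
   whence the bound on the expectation.

   The indicators of these events are not negatively correlated: an edge joining
   two neighbours x, y of v delays the spokes of both.  Expose the edges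
   backwards in time; each exposed edge is uniform among the remaining ones.
   With D_x the remaining degree, A_x the number of remaining spokes at x and
   kappa = e^lambda - 1,
     prod_(x in N(v)) (1 + kappa (D_x - Delta_x)^+ / D_x)^(A_x + 1)
   times e^(lambda * #missed so far) is a supermartingale.  An edge xy inside
   N(v) is handled by r_x r_y <= (r_x^2 + r_y^2) / 2, and the loss this causes
   is compensated by the extra 1 in the exponent.  In the end that extra factor
   is at most e^lambda for each x in N(v), which is paid for by the fact that
   N(v) itself is always contained in the approximate ball.  So the misses in
   excess of |N(v)| obey the Chernoff-Hoeffding bound for |L_2(v)| independent
   Bernoulli(eps) variables. *)

(** * Hoeffding's lemma for a Bernoulli variable *)

Section BernoulliMgf.
Import interval normedtype derive realfun numFieldNormedType.Exports.

Lemma is_derive_ge0_homo (R : realType) (f df : R -> R) (x : R) :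
  (forall y : R, is_derive y (1 : R) f (df y)) -> (forall y, 0 <= y -> 0 <= df y) ->
  0 <= x -> f 0 <= f x.
Proof.
move=> fdf df0 x0.
have der y : derivable f y 1 by have := fdf y => -[].
apply: (@ger0_derive1_ndecry _ f 0) => //.
  move=> y; rewrite in_itv /= andbT => y0.
  by rewrite derive1E (@derive_val _ _ _ _ _ _ _ (fdf y)) df0 // ltW.
exact: derivable_within_continuous.
Qed.

(** As a function of [x], the left side divided by the right side is 1 at 0 and does not increase on
    the nonnegative axis; [h] below is minus this quotient. *)
Lemma bernoulli_mgf_le (R : realType) (p x : R) :
  0 <= p < 1 -> 0 <= x -> 1 + p * (expR x - 1) <= expR (p * x + x ^+ 2 / 8).
Proof.
move=> /andP[p0 p1] x0.
pose D y : R := 1 - p + p * expR y.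
have D0 y : 0 < D y by rewrite /D; have := expR_gt0 y; nra.
(* [k] is the derivative of [p * y + y ^+ 2 / 8 - ln (D y)], with [p * expR y / D y] written as
   [1 - (1 - p) / D y]. *)
pose k y : R := p + y / 4 - 1 + (1 - p) * (D y)^-1.
pose dk y : R := 1 / 4 - (1 - p) * (D y)^- 2 * (p * expR y).
have dD (y : R) : is_derive y (1 : R) D (p * expR y).
  rewrite /D; apply: is_derive_eq. by rewrite add0r /GRing.scale /= mul1r.
have dDV (y : R) : is_derive y (1 : R) (fun y => (D y)^-1) (- (D y) ^- 2 * (p * expR y)).
  have Dn : D y != 0 by rewrite gt_eqF.
  split; first by apply: derivableV => //; have := dD y => -[].
  by rewrite deriveV //; have := dD y => -[_ ->].
have dkP (y : R) : is_derive y (1 : R) k (dk y).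
  rewrite /k; apply: is_derive_eq.
  by rewrite /dk /GRing.scale /=; ring.
have k0 y : 0 <= y -> 0 <= k y.
  move=> y0; have <- : k 0 = 0 by rewrite /k /D expR0; field; lra.
  apply: (is_derive_ge0_homo dkP) => // z _.
  rewrite /dk subr_ge0 mulrAC ler_pdivrMr ?exprn_gt0 //.
  (* AM-GM: [4 * a * b <= (a + b) ^+ 2] for [a = 1 - p] and [b = p * expR z], whose sum is [D z]. *)
  have := sqr_ge0 (1 - p - p * expR z); rewrite /D; nra.
pose h y : R := - (D y * expR (- (p * y + y ^+ 2 / 8))).
pose dh y : R := D y * k y * expR (- (p * y + y ^+ 2 / 8)).
have dhP (y : R) : is_derive y (1 : R) h (dh y).
  rewrite /h; apply: is_derive_eq.
  rewrite /dh /k /GRing.scale /= /D; field; rewrite -/(D y); exact/lt0r_neq0.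
have := @is_derive_ge0_homo _ h dh x dhP _ x0.
rewrite /h /D expR0 mulr0 expr0n /= mul0r addr0 oppr0 expR0 !mulr1 expRN.
rewrite lerN2 ler_pdivrMr ?expR_gt0 // subrK mul1r => H.
apply: le_trans (H _); first by lra.
by move=> y y0; rewrite /dh !mulr_ge0 ?k0 ?expR_ge0 // ltW.
Qed.

End BernoulliMgf.

(** * Polynomial inequalities for the edges at one neighbour *)

Lemma expr_onem_le1 (R : realFieldType) (a : nat) (y : R) :
  0 <= y <= 1 -> (1 - y) ^+ a.+1 * (1 + a%:R * y) <= 1.
Proof.
move=> /andP[y0 y1]; elim: a => [|a IH]; first by rewrite mul0r addr0 mulr1 expr1; lra.
apply: le_trans IH; rewrite exprS -mulrA mulrCA; apply: ler_wpM2l.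
  by apply: exprn_ge0; lra.
have : 0 <= a%:R :> R by []. 
rewrite -natr1; nra.
Qed.

(** The right side is [1 - z] times the sum of the powers [z ^+ i] with [i <= 2 * a], and by AM-GM
    this sum is at least [2 * a + 1] times its middle term. The induction shifts the sum by a factor
    [z] and adds the outer pair [1], [z ^+ (2 * a + 2)]. *)
Lemma middle_power_le (R : realFieldType) (a : nat) (z : R) :
  0 <= z <= 1 -> (2 * a%:R + 1) * (1 - z) * z ^+ a <= 1 - z ^+ (2 * a).+1.
Proof.
move=> /andP[z0 z1]; elim: a => [|a IH].
  by rewrite mulr0 add0r !mul1r expr0 expr1 mulr1.
have p0 : 0 <= z ^+ a by rewrite exprn_ge0.
have E : z ^+ (2 * a) = (z ^+ a) ^+ 2 by rewrite -exprM mulnC.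
rewrite mulnS 2!addSn add0n !exprS E in IH *; rewrite -natr1.
set p := z ^+ a in IH p0 *.
have IHz := ler_wpM2l z0 IH.
have amgm : 0 <= (1 - z) * (1 - z * p) ^+ 2.
  by apply: mulr_ge0; [lra | exact: sqr_ge0].
suff -> : 1 - z * (z * (z * p ^+ 2)) =
  z * (1 - z * p ^+ 2) + (1 - z) * (1 - z * p) ^+ 2 + 2 * (1 - z) * (z * p).
  move: IHz amgm; set X := z * (1 - _); set Y := (1 - z) * _ ^+ 2 => IHz Y0.
  by lra.
by ring.
Qed.

(* The left side is affine in [d]; it is nonpositive at [d = a], and its slope
   is nonpositive. *)
Lemma star_poly_ineq (R : realFieldType) (a d : nat) (y : R) :
  (a <= d)%N -> 0 <= y <= 1 ->
  a%:R * ((1 - y) ^+ a * (1 + (d%:R - 1) * y) - 1)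
    + (d - a)%:R * (((1 - y) ^+ a.+1) ^+ 2 - 1) / 2 <= 0.
Proof.
move=> ad y01; have z01 : 0 <= 1 - y <= 1 by move: y01; lra.
have slope : a%:R * (1 - y) ^+ a * y + (((1 - y) ^+ a.+1) ^+ 2 - 1) / 2 <= 0.
  have := middle_power_le a z01.
  have [z0 z1] := andP z01; have [y0 y1] := andP y01.
  have : (1 - y) ^+ a.+1 ^+ 2 <= (1 - y) ^+ (2 * a).+1.
    by rewrite -exprM; apply: ler_wiXn2l => //; lia.
  have : 0 <= y * (1 - y) ^+ a by apply: mulr_ge0 => //; apply: exprn_ge0.
  have key (s' s q r : R) : 0 <= q -> s' <= s -> 2 * r + q <= 1 - s ->
      r + (s' - 1) / 2 <= 0 by move=> *; lra.
  move=> q0 ss' qr; apply: key q0 ss' _; rewrite subKr in qr.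
  by apply: le_trans qr; rewrite le_eqVlt; apply/orP; left; apply/eqP; ring.
have base : a%:R * ((1 - y) ^+ a * (1 + (a%:R - 1) * y) - 1) <= 0.
  case: a {ad slope} => [|a]; first by rewrite mul0r.
  rewrite pmulr_rle0 ?ltr0n // subr_le0.
  by have := expr_onem_le1 a y01; rewrite -natr1 addrK.
have dE : d%:R = a%:R + (d - a)%:R :> R by rewrite -natrD subnKC.
have e0 : 0 <= (d - a)%:R :> R by [].
have := ler_wpM2l e0 slope; rewrite mulr0 dE.
move: ((d - a)%:R) => e; move: ((1 - y) ^+ a.+1 ^+ 2) base => s; move: ((1 - y) ^+ a) => p.
by nra.
Qed.

(* Truncated subtraction: the ratio is 0 as soon as [d <= f]. *)
Definition miss_ratio (R : realFieldType) (f d : nat) : R := (d - f)%:R / d%:R.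

(** This is the drift at a centre with [d] remaining edges, [a] of them spokes. The identity
    [d * P = (1 + kappa) + (d - 1) * P'] gives [(1 + kappa) / P = 1 + (d - 1) * y] for
    [y = 1 - P' / P], which reduces the claim to [star_poly_ineq]. *)
Lemma star_ineq (R : realFieldType) (kappa : R) (f a d : nat) :
  0 <= kappa -> (0 < f < d)%N -> (a <= d)%N ->
  let P := 1 + kappa * miss_ratio R f d in
  let P' := 1 + kappa * miss_ratio R f d.-1 in
  a%:R * ((1 + kappa) * P' ^+ a / P ^+ a.+1 - 1)
    + (d - a)%:R * ((P' ^+ a.+1 / P ^+ a.+1) ^+ 2 - 1) / 2 <= 0.
Proof.
move=> k0 /andP[f0 fd] ad /=; rewrite /miss_ratio.
have [n dE] : exists n, d = (f + n).+1 by exists (d - f).-1; lia.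
have -> : (d - f = n.+1)%N by lia.
have -> : (d.-1 - f = n)%N by lia.
have -> : (d.-1 = f + n)%N by lia.
set P := 1 + kappa * (n.+1%:R / _); set P' := 1 + kappa * (n%:R / _).
have f0R : 0 < f%:R :> R by rewrite ltr0n.
have n0R : 0 <= n%:R :> R by [].
have dR : d%:R = f%:R + n%:R + 1 :> R by rewrite dE -natr1 natrD.
have P0 : 0 < P by rewrite /P; apply: ltr_pwDl => //; rewrite mulr_ge0 // divr_ge0.
have P'0 : 0 < P' by rewrite /P'; apply: ltr_pwDl => //; rewrite mulr_ge0 // divr_ge0.
pose y := 1 - P' / P.
have Pne : f%:R + n%:R + 1 + kappa * (n%:R + 1) != 0 :> R by apply: lt0r_neq0; nra.
have dne : f%:R + n%:R + 1 != 0 :> R by lra.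
have d'ne : f%:R + n%:R != 0 :> R by lra.
have yE : y = kappa * f%:R / ((f%:R + n%:R) * (f%:R + n%:R + 1 + kappa * (n%:R + 1))).
  rewrite /y /P /P' dR natrD -natr1; field.
  by rewrite dne d'ne Pne.
have y01 : 0 <= y <= 1.
  apply/andP; split.
    by rewrite yE divr_ge0 ?mulr_ge0 //; nra.
  by rewrite /y gerBl divr_ge0 ?ltW.
have KP : (1 + kappa) / P = 1 + (d%:R - 1) * y.
  rewrite yE /P dR -natr1; field.
  by rewrite dne d'ne Pne.
have -> : (1 + kappa) * P' ^+ a / P ^+ a.+1 = (1 - y) ^+ a * (1 + (d%:R - 1) * y).
  rewrite -KP /y subKr exprMn exprS invfM exprVn; ring.
have -> : P' ^+ a.+1 / P ^+ a.+1 = (1 - y) ^+ a.+1.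
  by rewrite /y subKr exprMn exprVn.
exact: star_poly_ineq.
Qed.

(** * Backward exposure of a uniformly random edge order *)

Section RandomOrder.
Variables (V : finType) (E : {set {set V}}) (k : nat).
Implicit Types (w : outcome E k) (i j l : 'I_#|E|) (g : {set {set V}}).

Lemma edge_at_inj w : injective (edge_at w).
Proof. by move=> i j /enum_val_inj /perm_inj. Qed.

Lemma edge_atP w i : edge_at w i \in E.
Proof. exact: enum_valP. Qed.

Lemma graph_at_sub t w : graph_at t w \subset E.
Proof. by apply/subsetP => _ /imsetP[i _ ->]; apply: edge_atP. Qed.

Lemma graph_at0 w : graph_at 0 w = set0.
Proof. by apply/setP => e; rewrite inE; apply/negbTE/imsetP => -[i]; rewrite inE. Qed.

Lemma mem_graph_at t w i : (edge_at w i \in graph_at t w) = (i < t)%N.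
Proof.
apply/imsetP/idP => [[j jt /edge_at_inj ->]|it]; first by rewrite inE in jt.
by exists i; rewrite ?inE.
Qed.

Lemma graph_atS w i : graph_at i.+1 w = edge_at w i |: graph_at i w.
Proof.
apply/setP => e; rewrite in_setU1; apply/imsetP/orP => [[j]|].
  rewrite inE ltnS leq_eqVlt => /orP[/eqP/val_inj->|ji] ->; first by left.
  by right; rewrite mem_graph_at.
case=> [/eqP->|/imsetP[j]]; first by exists i; rewrite ?inE.
by rewrite inE => ji ->; exists j; rewrite ?inE // ltnS ltnW.
Qed.

Lemma graph_atD w i : graph_at i.+1 w :\ edge_at w i = graph_at i w.
Proof. by rewrite graph_atS setU1K // mem_graph_at ltnn. Qed.

Lemma card_graph_at t w : (t <= #|E|)%N -> #|graph_at t w| = t.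
Proof.
move=> tE; rewrite card_imset; last exact: edge_at_inj.
rewrite -sum1dep_card; have /= <- := big_ord_widen _ (fun=> 1%N) tE.
by rewrite sum1_card card_ord.
Qed.

Definition swap_edges l i w : outcome E k := ((tperm l i * w.1)%g, w.2).

Lemma swap_edgesK l i : involutive (swap_edges l i).
Proof. by case=> p r; rewrite /swap_edges /= mulgA tperm2 mul1g. Qed.

Lemma edge_at_swap l i w j :
  edge_at (swap_edges l i w) j = edge_at w (tperm l i j).
Proof. by rewrite /edge_at permM. Qed.

Lemma graph_at_swap l i w t :
  ((l < t) = (i < t))%N -> graph_at t (swap_edges l i w) = graph_at t w.
Proof.
move=> lit.
have st j : (tperm l i j < t)%N = (j < t)%N by case: tpermP => // ->.
apply/setP => e; apply/imsetP/imsetP => -[j]; rewrite inE => jt ->.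
  by exists (tperm l i j); rewrite ?inE ?st // edge_at_swap.
by exists (tperm l i j); rewrite ?inE ?st // edge_at_swap tpermK.
Qed.

Lemma sum_graph_at (R : realType) t w (F : {set V} -> R) :
  \sum_(e in graph_at t w) F e = \sum_(i < #|E| | (i < t)%N) F (edge_at w i).
Proof.
rewrite /graph_at big_imset /=; last by move=> i j _ _ /edge_at_inj.
by apply: eq_bigl => i; rewrite inE.
Qed.

(* Edges are exposed backwards in time: swapping positions [i] and [l <= i]
   shows that the edge inserted at time [i] is uniform in [graph_at i.+1]
   given all later edges, so the hypothesis on [Psi] makes the partial products
   a supermartingale. *)
Lemma random_order_bound (R : realType) (c : {set {set V}} -> {set V} -> R)
    (Psi : {set {set V}} -> R) t (w0 : outcome E k) :
  (t <= #|E|)%N ->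
  (forall g e, 0 <= c g e) ->
  (forall g, g \subset graph_at t w0 ->
     \sum_(e in g) c g e * Psi (g :\ e) <= #|g|%:R * Psi g) ->
  \sum_(w : outcome E k | graph_at t w == graph_at t w0)
     (\prod_(j < #|E| | (j < t)%N) c (graph_at j.+1 w) (edge_at w j))
       * Psi set0
  <= #|[set w : outcome E k | graph_at t w == graph_at t w0]|%:R
       * Psi (graph_at t w0).
Proof.
move=> tE c0 superm.
pose P w := graph_at t w == graph_at t w0.
pose X n w := \prod_(j < #|E| | (n <= j < t)%N) c (graph_at j.+1 w) (edge_at w j).
suff step n : (n <= t)%N ->
    \sum_(w | P w) X n w * Psi (graph_at n w) <=
    #|[set w | P w]|%:R * Psi (graph_at t w0).
  apply: le_trans (step 0%N _) => //.
  by apply: ler_sum => w _; rewrite /X graph_at0.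
move=> nt; rewrite -(subKn nt); move: (t - n)%N (leq_subr n t) => m.
elim: m => [_|m IH mt].
  rewrite subn0 (eq_bigr (fun=> Psi (graph_at t w0))); last first.
    move=> w /eqP ->; rewrite /X big_pred0 ?mul1r // => j.
    by apply/andP => -[]; lia.
  by rewrite sumr_const mulr_natl cardsE.
apply: le_trans (IH (ltnW mt)); set n0 := (t - m.+1)%N.
have n0E : (n0 < #|E|)%N by rewrite /n0; lia.
pose i := Ordinal n0E.
have -> : (t - m)%N = i.+1 by rewrite /= /n0; lia.
have -> : n0 = i by [].
have it : (i < t)%N by rewrite /= /n0; lia.
have XS w : X i w = c (graph_at i.+1 w) (edge_at w i) * X i.+1 w.
  rewrite /X (bigD1 i) /= ?it ?leqnn //; congr (_ * _); apply: eq_bigl => j.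
  by rewrite -val_eqE /=; lia.
have Xswap l w : (l <= i)%N -> X i.+1 (swap_edges l i w) = X i.+1 w.
  move=> li; apply: eq_bigr => j /andP[ij jt].
  rewrite graph_at_swap ?edge_at_swap ?tpermD //; first last.
  - by lia.
  - by apply: contraTneq ij => <-; rewrite ltnn.
  - by apply: contraTneq li => ->; rewrite -ltnNge.
(* Multiplying by [i.+1], the size of [graph_at i.+1 w], yields one copy of the sum for each
   position [l <= i]; copy [l] is reindexed by [swap_edges l i]. *)
rewrite -(ler_pM2l (ltr0Sn R i)).
have -> : i.+1%:R * (\sum_(w | P w) X i w * Psi (graph_at i w)) =
   \sum_(w | P w) \sum_(l < #|E| | (l < i.+1)%N)
      c (graph_at i.+1 w) (edge_at w l) * Psi (graph_at i.+1 w :\ edge_at w l)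
      * X i.+1 w.
  rewrite exchange_big /= -[i.+1 in LHS](card_graph_at w0 n0E).
  rewrite mulr_natl -sumr_const sum_graph_at.
  apply: eq_bigr => l li.
  rewrite (reindex_inj (inv_inj (swap_edgesK l i))) /=.
  have Ps w : P (swap_edges l i w) = P w by rewrite /P graph_at_swap //; lia.
  apply: eq_big => // w Pw.
  rewrite XS Xswap // -(graph_atD _ i) graph_at_swap; last by rewrite li ltnSn.
  by rewrite edge_at_swap tpermR mulrAC.
rewrite mulr_sumr; apply: ler_sum => w Pw.
rewrite -mulr_suml mulrCA [X in _ <= X]mulrC.
rewrite -(sum_graph_at i.+1 w (fun e => c (graph_at i.+1 w) e * Psi (graph_at i.+1 w :\ e))).
apply: ler_wpM2r; first by rewrite /X; apply: prodr_ge0.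
have := superm (graph_at i.+1 w); rewrite card_graph_at //; apply.
rewrite -(eqP Pw); apply/subsetP => e /imsetP[j]; rewrite inE => ji ->.
by rewrite mem_graph_at; lia.
Qed.
End RandomOrder.

(** * Balls and degrees as edges are added or removed *)

Section Balls.
Variable V : finType.
Implicit Types (g h : {set {set V}}) (e : {set V}) (x y z : V).

Lemma adj_sym g x y : adj g x y = adj g y x.
Proof. by rewrite /adj setUC. Qed.

Lemma dist_leP g n x y :
  reflect (exists p, [/\ (size p <= n)%N, path (adj g) x p & last x p = y])
          (dist_le g n x y).
Proof.
apply: (iffP existsP) => [[m /existsP[p /andP[xp /eqP lp]]]|[p [pn xp lp]]].
  by exists p; rewrite size_tuple -ltnS ltn_ord.
exists (Ordinal (pn : (size p < n.+1)%N)); apply/existsP.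
by exists (in_tuple p); rewrite xp lp eqxx.
Qed.

Lemma in_ball1 g x y : (y \in ball1 g x) = (y == x) || adj g x y.
Proof. by rewrite !inE. Qed.

Lemma dist_le1E g x y : dist_le g 1 x y = (y \in ball1 g x).
Proof.
rewrite in_ball1; apply/dist_leP/orP.
  case=> p []; case: p => [|z [|//]] _ /= xp <-; first by left.
  by right; case/andP: xp.
case=> [/eqP->|xy]; first by exists [::].
by exists [:: y]; rewrite /= xy.
Qed.

Lemma in_ball2 g x y :
  (y \in ball2 g x) =
  (y \in ball1 g x) || [exists z, adj g x z && adj g z y].
Proof.
rewrite inE -dist_le1E; apply/dist_leP/orP.
  case=> p []; case: p => [|z [|t [|//]]] _ /= xp <-.
  - by left; apply/dist_leP; exists [::].
  - by left; apply/dist_leP; exists [:: z].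
  - by case/and3P: xp => xz zt _; right; apply/existsP; exists z; rewrite xz.
case=> [/dist_leP[p [sp xp lp]]|/existsP[z /andP[xz zy]]].
  by exists p; split=> //; apply: leq_trans sp _.
by exists [:: z; y]; rewrite /= xz zy.
Qed.

Lemma layer2E g x : layer2 g x = ball2 g x :\: ball1 g x.
Proof. by apply/setP => y; rewrite in_setD !inE dist_le1E !inE andbC. Qed.

Lemma ball1_sub_ball2 g x : ball1 g x \subset ball2 g x.
Proof. by apply/subsetP => y; rewrite in_ball2 => ->. Qed.

Lemma ball1_nbr_sub_ball2 g x z : adj g z x -> ball1 g x \subset ball2 g z.
Proof.
move=> zx; apply/subsetP => y; rewrite in_ball2 !in_ball1.
case/orP => [/eqP->|xy]; first by rewrite zx orbT.
by apply/orP; right; apply/existsP; exists x; rewrite zx.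
Qed.

Lemma adjS g h x y : g \subset h -> adj g x y -> adj h x y.
Proof. by move/subsetP; apply. Qed.

Lemma ball1S g h x : g \subset h -> ball1 g x \subset ball1 h x.
Proof.
move=> gh; apply/subsetP => y; rewrite !in_ball1.
by case/orP => [->//|/(adjS gh) ->]; rewrite orbT.
Qed.

Lemma ball2S g h x : g \subset h -> ball2 g x \subset ball2 h x.
Proof.
move=> gh; apply/subsetP => y; rewrite !in_ball2.
case/orP => [/(subsetP (ball1S x gh)) -> //|/existsP[z /andP[xz zy]]].
by apply/orP; right; apply/existsP; exists z; rewrite !(adjS gh).
Qed.

Lemma nbhd0 x : nbhd set0 x = set0.
Proof. by apply/setP => y; rewrite !inE /adj inE. Qed.

Lemma set2_inj x y z : [set x; y] = [set x; z] -> y = z.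
Proof.
move=> e; have : y \in [set x; z] by rewrite -e set22.
rewrite !inE => /orP[/eqP yx|/eqP//]; move: (set22 x z).
by rewrite -e !inE yx orbb => /eqP ->.
Qed.

Lemma nbhdU1 g x y : nbhd ([set x; y] |: g) x = y |: nbhd g x.
Proof.
apply/setP => z; rewrite !inE /adj in_setU1; congr (_ || _).
by apply/eqP/eqP => [/set2_inj|->].
Qed.

Lemma nbhdU1_id g e x : x \notin e -> nbhd (e |: g) x = nbhd g x.
Proof.
move=> xe; apply/setP => z; rewrite !inE /adj in_setU1.
by case: eqP => // eE; rewrite -eE set21 in xe.
Qed.

(** Incident edges are counted instead of neighbours, so that adding or removing an edge shifts the
    degree by its incidence with [x], whether or not the graph is simple. *)
Definition deg g x := #|[set e in g | x \in e]|.

Lemma deg0 x : deg set0 x = 0%N.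
Proof. by apply/eqP; rewrite cards_eq0; apply/eqP/setP => e; rewrite !inE. Qed.

Lemma degU1 g e x : e \notin g -> deg (e |: g) x = ((x \in e) + deg g x)%N.
Proof.
move=> eg; rewrite /deg (cardsD1 e) !inE eqxx /=; congr (_ + _)%N.
apply: eq_card => a; rewrite !inE; case: eqP => //= ->.
by rewrite (negbTE eg).
Qed.

Lemma degD1 g e x : e \in g -> deg g x = ((x \in e) + deg (g :\ e) x)%N.
Proof. by move=> eg; rewrite -{1}(setD1K eg) degU1 // setD11. Qed.

End Balls.

(** * Effect of one insertion on the stored sets and counters *)

Section Insertion.
Variables (R : realType) (V : finType) (phi : R) (k : nat).
Implicit Types (g : {set {set V}}) (s : state V) (x y z : V).

Definition tick (c : nat * nat) : nat * nat :=
  if phi * c.1%:R <= c.2.+1%:R then ((c.1 + c.2.+1)%N, 0%N) else (c.1, c.2.+1).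

(* The values of [Delta] and [delta] at a vertex depend on its degree only. *)
Definition counters n := iter n tick (0%N, 0%N).

Lemma counters_add n : ((counters n).1 + (counters n).2 = n)%N.
Proof. by elim: n => //= n IH; rewrite /tick; case: ifP => /= _; lia. Qed.

Lemma counters_le n : ((counters n).1 <= n)%N.
Proof. by have := counters_add n; lia. Qed.

(** A heavy step resets [delta] to 0, and a light step is one whose new [delta] still fails the
    test. Together with [counters_add] this bounds [Delta] below in terms of the degree. *)
Lemma counters_ratio n : 0 <= phi -> (counters n).2%:R <= phi * (counters n).1%:R.
Proof.
move=> phi0; case: n => [|n] /=; first by rewrite mulr0.
rewrite /tick; case: ifPn => /= [_|]; first by rewrite mulr_ge0.
by rewrite -ltNge => /ltW.
Qed.

Lemma random_nbr_adj g x (p : {perm V}) z :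
  random_nbr g x p = Some z -> z \in nbhd g x.
Proof.
rewrite /random_nbr; set l := [seq _ <- _ | _].
have : all (mem (nbhd g x)) l by apply: filter_all.
by case: l => //= a l /andP[ax _] [<-].
Qed.

Lemma tB1_process g (w : 'I_k -> {perm V}) x y s :
  tB1 (process phi g w x y s) = upd (tB1 s) x (tB1 s x :|: [set y]).
Proof. by rewrite /process; case: ifP. Qed.

Lemma process_counters g (w : 'I_k -> {perm V}) x y s z :
  (Delta (process phi g w x y s) z, delta (process phi g w x y s) z) =
  if z == x then tick (Delta s x, delta s x) else (Delta s z, delta s z).
Proof.
by rewrite /process /tick /=; case: ifP => _ /=; rewrite /upd; case: eqVneq => // ->.
Qed.

Lemma process_tB2_mono g (w : 'I_k -> {perm V}) x y s z :
  tB2 s z \subset tB2 (process phi g w x y s) z.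
Proof.
have H : tB2 s z \subset
    upd (tB2 s) x (tB2 s x :|: upd (tB1 s) x (tB1 s x :|: [set y]) y) z.
  by rewrite /upd; case: (z =P x) => [->|_] //; apply: subsetUl.
rewrite /process; case: ifP => _ /=; case: ifP => _ //;
  exact: subset_trans H (subsetUl _ _).
Qed.

Lemma process_tB2_endpoint g (w : 'I_k -> {perm V}) x y s :
  y != x -> tB1 s y \subset tB2 (process phi g w x y s) x.
Proof.
move=> yx.
have H : tB1 s y \subset
    upd (tB2 s) x (tB2 s x :|: upd (tB1 s) x (tB1 s x :|: [set y]) y) x.
  by rewrite /upd eqxx (negbTE yx) subsetUr.
rewrite /process; case: ifP => _ /=; case: ifP => _ //;
  exact: subset_trans H (subsetUl _ _).
Qed.

Lemma process_tB2_heavy g (w : 'I_k -> {perm V}) x y s z :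
  phi * (Delta s x)%:R <= (delta s x).+1%:R -> z \in nbhd g x ->
  tB1 (process phi g w x y s) x \subset tB2 (process phi g w x y s) z.
Proof. by rewrite /process => -> zx /=; rewrite zx subsetUr. Qed.

Definition sound g s :=
  forall z, tB1 s z \subset ball1 g z /\ tB2 s z \subset ball2 g z.

Lemma process_sound g (w : 'I_k -> {perm V}) x y s :
  adj g x y -> sound g s -> sound g (process phi g w x y s).
Proof.
move=> xy ss; pose b1 := upd (tB1 s) x (tB1 s x :|: [set y]).
have sb1 z : b1 z \subset ball1 g z.
  rewrite /b1 /upd; case: eqP => [->|_]; last by case: (ss z).
  by rewrite subUset sub1set in_ball1 xy orbT andbT; case: (ss x).
have sb2 z : upd (tB2 s) x (tB2 s x :|: b1 y) z \subset ball2 g z.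
  rewrite /upd; case: eqP => [->|_]; last by case: (ss z).
  rewrite subUset; apply/andP; split; first by case: (ss x).
  exact: subset_trans (sb1 y) (ball1_nbr_sub_ball2 xy).
move=> z; split; first by rewrite tB1_process.
have sx : z \in nbhd g x -> b1 x \subset ball2 g z.
  rewrite inE adj_sym => zx.
  exact: subset_trans (sb1 x) (ball1_nbr_sub_ball2 zx).
rewrite /process; case: ifP => _ /=; case: ifP => [zx|_] //.
  by rewrite subUset sb2 sx.
rewrite subUset sb2 /=; apply: sx.
by case/existsP: zx => i /eqP /random_nbr_adj.
Qed.

Section Insert.
Variables (g : {set {set V}}) (w : bool -> 'I_k -> {perm V}) (a b : V).
Variable s : state V.
Hypothesis ab : a != b.
Let s1 := process phi g (w false) a b s.
Let s' := insert phi g w (a, b) s.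

Lemma insert_tB1 x : tB1 s' x =
  if x == a then tB1 s x :|: [set b] else
  if x == b then tB1 s x :|: [set a] else tB1 s x.
Proof.
rewrite /s' /insert !tB1_process /upd /=.
case: (eqVneq x a) => [->|xa]; first by rewrite (negbTE ab).
by case: (eqVneq x b) => [->|] //; rewrite eq_sym (negbTE ab).
Qed.

Lemma insert_counters x : (Delta s' x, delta s' x) =
  if x \in [set a; b] then tick (Delta s x, delta s x)
  else (Delta s x, delta s x).
Proof.
rewrite /s' /insert process_counters !process_counters /= !inE.
case: (eqVneq x b) => [->|xb]; last by rewrite orbF; case: (eqVneq x a) => [->|].
by rewrite orbT eq_sym (negbTE ab).
Qed.

Lemma insert_tB2_mono z : tB2 s z \subset tB2 s' z.
Proof. exact: subset_trans (process_tB2_mono _ _ _ _ _ _) (process_tB2_mono _ _ _ _ _ _). Qed.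

Lemma tB1_process_mono x : tB1 s x \subset tB1 s1 x.
Proof. by rewrite tB1_process /upd; case: eqP => [->|]; rewrite ?subsetUl. Qed.

Lemma insert_tB2_endpoint z x :
  [set z; x] = [set a; b] -> tB1 s x \subset tB2 s' z.
Proof.
move=> e; have /set2P[za|zb] : z \in [set a; b] by rewrite -e set21.
  rewrite za in e *; rewrite (set2_inj e).
  apply: subset_trans (process_tB2_mono _ _ _ _ _ _).
  by apply: process_tB2_endpoint; rewrite eq_sym.
rewrite zb in e *; rewrite [RHS]setUC in e; rewrite (set2_inj e).
exact: subset_trans (tB1_process_mono _) (process_tB2_endpoint _ _ _ ab).
Qed.

(** The test can be read in the state [s] before the insertion: processing [a] does not touch the
    counters of [b], and processing [b] does not touch the approximate 1-ball of [a]. *)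
Lemma insert_tB2_heavy x z :
  x \in [set a; b] -> phi * (Delta s x)%:R <= (delta s x).+1%:R ->
  z \in nbhd g x -> tB1 s' x \subset tB2 s' z.
Proof.
case/set2P => -> hx zx.
  have -> : tB1 s' a = tB1 s1 a by rewrite /s' /insert tB1_process /upd (negbTE ab).
  apply: subset_trans (process_tB2_mono _ _ _ _ _ _).
  exact: process_tB2_heavy.
apply: process_tB2_heavy => //.
have := process_counters g (w false) a b s b.
by rewrite eq_sym (negbTE ab) => -[-> ->].
Qed.

End Insert.
End Insertion.

(** * Deterministic invariant of the algorithm *)

Section Invariant.
Variables (R : realType) (V : finType) (phi : R) (k : nat).
Implicit Types (g : {set {set V}}) (s : state V).

(** [inv_tB2_sup] is what later lets the neighbours of a vertex absorb a number of misses in the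
    concentration bound. *)
Record invariant g s : Prop := Invariant {
  inv_tB1 : forall x, tB1 s x = ball1 g x;
  inv_tB2_sub : forall x, tB2 s x \subset ball2 g x;
  inv_tB2_sup : forall x, ball1 g x \subset tB2 s x;
  inv_counters : forall x, (Delta s x, delta s x) = counters phi (deg g x) }.

Lemma invariant_init : invariant set0 (init set0).
Proof.
split=> x //=; first by rewrite ball1_sub_ball2.
by rewrite nbhd0 cards0 deg0.
Qed.

Lemma insert_invariant g (w : bool -> 'I_k -> {perm V}) uv s :
  let e := [set uv.1; uv.2] in
  uv.1 != uv.2 -> e \notin g -> invariant g s ->
  invariant (e |: g) (insert phi (e |: g) w uv s).
Proof.
case: uv => a b /=; set e := [set a; b]; set g' := e |: g => ab eg inv.
have gg' : g \subset g' by apply: subsetUr.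
have adjab : adj g' a b by rewrite /adj setU11.
have e_ba : e = [set b; a] by rewrite /e setUC.
have B1 x : tB1 (insert phi g' w (a, b) s) x = ball1 g' x.
  rewrite insert_tB1 // (inv_tB1 inv) /ball1.
  case: eqP => [->|xa]; first by rewrite nbhdU1 -setUA [_ :|: [set b]]setUC.
  case: eqP => [->|xb].
    by rewrite /g' e_ba nbhdU1 -setUA [_ :|: [set a]]setUC.
  by rewrite nbhdU1_id // !inE; apply/norP; split; apply/eqP.
split => //.
- move=> x; suff /(_ x)[] : sound g' (insert phi g' w (a, b) s) by [].
  apply: process_sound; first by rewrite adj_sym.
  apply: process_sound => // z; rewrite (inv_tB1 inv) ball1S //.
  by split=> //; apply: subset_trans (inv_tB2_sub inv _) (ball2S _ gg').
- move=> x; apply/subsetP => y; rewrite in_ball1 => xy.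
  have [|] := boolP (y \in ball1 g x).
    move/(subsetP (inv_tB2_sup inv x)).
    exact: (subsetP (insert_tB2_mono _ _ _ _ _ _ _)).
  rewrite in_ball1 => /norP[yx xyg].
  have exy : [set x; y] = [set a; b].
    by case/orP: xy => [/eqP yx'|]; [rewrite yx' eqxx in yx|
      rewrite /adj in_setU1 => /orP[/eqP//|]; rewrite -/(adj g x y) (negbTE xyg)].
  apply: (subsetP (insert_tB2_endpoint phi g' w s ab exy)).
  by rewrite (inv_tB1 inv) in_ball1 eqxx.
- move=> x; rewrite insert_counters // (inv_counters inv) degU1 // -/e.
  by case: (x \in e).
Qed.

End Invariant.

(** * Which vertices at distance 2 the algorithm finds *)

Section Correctness.
Variables (R : realType) (V : finType) (E : {set {set V}}).
Variables (orient : {set V} -> V * V) (phi : R) (k : nat).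
Hypothesis simpleE : simple_graph E.
Hypothesis orientE : orientation E orient.
Variable w : outcome E k.

Lemma lazy_algS (i : 'I_#|E|) :
  lazy_alg orient phi i.+1 w =
  insert phi (graph_at i.+1 w) (fun b j => w.2 (i, b, j))
    (orient (edge_at w i)) (lazy_alg orient phi i w).
Proof.
rewrite /lazy_alg (take_nth i) ?size_enum_ord // foldl_rcons.
by rewrite nth_ord_enum.
Qed.

Lemma orient_neq (i : 'I_#|E|) :
  (orient (edge_at w i)).1 != (orient (edge_at w i)).2.
Proof.
apply/eqP => e12; have := simpleE (edge_atP w i).
by rewrite (orientE (edge_atP w i)) e12 setUid cards1.
Qed.

Lemma lazy_alg_invariant t : (t <= #|E|)%N ->
  invariant phi (graph_at t w) (lazy_alg orient phi t w).
Proof.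
elim: t => [_|t IH tE]; first by rewrite graph_at0 /lazy_alg take0; apply: invariant_init.
pose i := Ordinal tE; rewrite -[t.+1]/(i.+1) lazy_algS.
rewrite graph_atS {1 2}(orientE (edge_atP w i)).
apply: insert_invariant; rewrite -?(orientE (edge_atP w i)).
- exact: orient_neq.
- by rewrite mem_graph_at ltnn.
- exact: IH (ltnW tE).
Qed.

(* [deg (graph_at j.+1 w) x] is the rank of the [j]-th edge among the edges at
   [x]: the last heavy step of [x] propagates all edges of rank at most [Delta],
   and [counters _ _].1 is the current value of [Delta]. *)
Lemma lazy_alg_seen t z x u (j : 'I_#|E|) : (t <= #|E|)%N -> (j < t)%N ->
  edge_at w j = [set x; u] ->
  (deg (graph_at j.+1 w) x <= (counters phi (deg (graph_at t w) x)).1)%N ->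
  adj (graph_at t w) z x -> u \in tB2 (lazy_alg orient phi t w) z.
Proof.
elim: t => // t IH tE; pose i := Ordinal tE; rewrite -[t.+1]/(i.+1).
move=> ji ej rj zx; have inv := lazy_alg_invariant (ltnW tE).
have inv' := lazy_alg_invariant tE.
rewrite lazy_algS in inv' *.
have oi := orientE (edge_atP w i); have ne := orient_neq i.
case: (orient _) oi ne inv' => a b /= oi ab inv'.
have ge : edge_at w i \notin graph_at i w by rewrite mem_graph_at ltnn.
have xu : adj (graph_at i.+1 w) x u by rewrite /adj -ej mem_graph_at.
have mono := insert_tB2_mono phi (graph_at i.+1 w)
  (fun b j => w.2 (i, b, j)) a b (lazy_alg orient phi i w).
have dS : deg (graph_at i.+1 w) x = ((x \in [set a; b]) + deg (graph_at i w) x)%N.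
  by rewrite graph_atS degU1 // oi.
have old : (j < i)%N -> adj (graph_at i w) z x ->
    (deg (graph_at j.+1 w) x <= (counters phi (deg (graph_at i w) x)).1)%N ->
    u \in tB2 (insert phi (graph_at i.+1 w) (fun b j => w.2 (i, b, j)) (a, b)
                 (lazy_alg orient phi i w)) z.
  by move=> ji' zx' rj'; apply: (subsetP (mono z)); apply: IH => //; apply: ltnW.
have jcase : j = i \/ (j < i)%N.
  by move: ji; rewrite ltnS leq_eqVlt => /orP[/eqP/val_inj|]; [left|right].
have zcase : [set z; x] = [set a; b] \/ adj (graph_at i w) z x.
  by move: zx; rewrite {1}/adj graph_atS in_setU1 oi => /orP[/eqP|]; [left|right].
(* If the new edge meets [x], a heavy step sends the whole 1-ball of [x] to [z], while a light step
   keeps [Delta], so that the rank bound already held one step earlier. *)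
case: (boolP (x \in [set a; b])) => [xe|xe]; rewrite ?xe ?(negbTE xe) in dS.
  have [hx|lx] := boolP (phi * (Delta (lazy_alg orient phi i w) x)%:R <=
                         (delta (lazy_alg orient phi i w) x).+1%:R).
    apply: (subsetP (insert_tB2_heavy _ ab xe hx _)).
      by rewrite inE adj_sym.
    by rewrite (inv_tB1 inv') in_ball1 xu orbT.
  have {}rj : (deg (graph_at j.+1 w) x <= (counters phi (deg (graph_at i w) x)).1)%N.
    move: rj lx; rewrite dS /= /tick.
    by case: (counters _ _) (inv_counters inv x) => D d /= [-> ->] /[swap] /negbTE ->.
  (* If [xu] were the new edge, its rank would be the old degree plus 1, above the old [Delta]. If
     [zx] is the new edge, [z] receives the 1-ball of [x], which already contains [u]. *)
  case: jcase => [jE|ji'].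
    move: rj; rewrite jE dS => /leq_trans/(_ (counters_le _ _)).
    by rewrite add1n ltnn.
  case: zcase => [eq_e|]; last by move=> zx'; apply: old.
  apply: (subsetP (insert_tB2_endpoint phi _ _ _ ab eq_e)).
  by rewrite (inv_tB1 inv) in_ball1 /adj -ej mem_graph_at ji' orbT.
case: zcase => [eq_e|zx']; first by rewrite -eq_e set22 in xe.
rewrite dS in rj; apply: old => //.
by case: jcase => // jE; rewrite -oi -jE ej set21 in xe.
Qed.
End Correctness.

(** * Supermartingale potentials for backward exposure *)

Lemma prod_le_half_sum_sqr (R : realFieldType) (T : finType) (S : {set T}) (r : T -> R) :
  (#|S| <= 2)%N ->
  \prod_(x in S) r x <= 1 + \sum_(x in S) (r x ^+ 2 - 1) / 2.
Proof.
case cS : #|S| => [|[|[|//]]] _.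
- by move/eqP: cS; rewrite cards_eq0 => /eqP->; rewrite !big_set0 addr0.
- have /cards1P[a ->] : #|S| == 1%N by rewrite cS.
  by rewrite !big_set1; have := sqr_ge0 (r a - 1); nra.
- have /cards2P[a [b [ab ->]]] : #|S| == 2%N by rewrite cS.
  (* AM-GM, which splits the effect of an edge inside [N] into one term per endpoint. *)
  rewrite !big_setU1 ?inE //= !big_set1; have := sqr_ge0 (r a - r b); nra.
Qed.

Section Potentials.
Variables (R : realType) (V : finType) (N L : {set V}) (mid : V -> V).
Variables (f : V -> nat) (kappa : R).
Implicit Types (g : {set {set V}}) (e : {set V}) (x u : V).

Hypothesis kappa_ge0 : 0 <= kappa.
Hypothesis mid_in : forall u, u \in L -> mid u \in N.
Hypothesis LN0 : forall u, u \in L -> u \notin N.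
Hypothesis f_gt0 : forall x, x \in N -> (0 < f x)%N.

Definition spoke u := [set mid u; u].

(** When [e] is the last edge of [g], [deg g (mid u)] is its rank at [mid u] if it is the spoke of
    [u]. So the factor [1 + kappa] is paid exactly when exposing [e] reveals that [u] is missed. *)
Definition charge u g e : R :=
  if (e == spoke u) && (f (mid u) < deg g (mid u))%N then 1 + kappa else 1.

(** The conditional expectation of the charges still to come: a spoke in [g] has uniform rank among
    the edges of [g] at its centre, and [miss_ratio] is the probability that this rank exceeds
    [f]. *)
Definition potential1 u g : R :=
  1 + kappa * (if spoke u \in g then miss_ratio R (f (mid u)) (deg g (mid u)) else 0).

Lemma miss_ratio0 n d : (d <= n)%N -> miss_ratio R n d = 0.
Proof. by move=> dn; rewrite /miss_ratio (eqP dn) mul0r. Qed.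

Lemma miss_ratio_ge0 n d : 0 <= miss_ratio R n d.
Proof. exact: divr_ge0. Qed.

(** Only the case of an unexposed spoke with degree above [f] is not constant. There, edges away
    from the centre change nothing, and the [D] edges at it balance exactly by
    [D * P = (1 + kappa) + (D - 1) * P']. *)
Lemma potential1_super u g : u \in L ->
  \sum_(e in g) charge u g e * potential1 u (g :\ e) <= #|g|%:R * potential1 u g.
Proof.
move=> uL; have f0 := f_gt0 (mid_in uL).
have [ug|ug] := boolP (spoke u \in g); last first.
  rewrite (eq_bigr (fun=> 1)) => [|e eg].
    by rewrite sumr_const /potential1 (negbTE ug) mulr0 addr0 mulr1.
  rewrite /charge /potential1 inE (negbTE ug) andbF mulr0 addr0 mulr1.
  by case: eqP => // eu; rewrite -eu eg in ug.
have [Df|fD] := leqP (deg g (mid u)) (f (mid u)).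
  rewrite (eq_bigr (fun=> 1)) => [|e eg].
    by rewrite sumr_const /potential1 ug miss_ratio0 // mulr0 addr0 mulr1.
  rewrite /charge ltnNge Df andbF mul1r /potential1 miss_ratio0 ?if_same ?mulr0 ?addr0 //.
  by apply: leq_trans Df; rewrite (degD1 _ eg) leq_addl.
set x := mid u in f0 fD *; set D := deg g x in fD *.
have dE e : e \in g -> deg (g :\ e) x = (D - (x \in e))%N.
  by move=> eg; rewrite /D (degD1 x eg) addKn.
pose P := 1 + kappa * miss_ratio R (f x) D.
pose P' := 1 + kappa * miss_ratio R (f x) D.-1.
have -> : potential1 u g = P by rewrite /potential1 ug.
have -> : #|g|%:R * P = \sum_(e in g) P by rewrite sumr_const mulr_natl.
rewrite -subr_le0 -sumrB (bigID (fun e : {set V} => x \in e)) /=.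
rewrite [X in _ + X]big1 ?addr0 => [|e /andP[eg xe]]; last first.
  have eu : e == spoke u = false by apply: contraNF xe => /eqP->; apply: set21.
  rewrite /charge /potential1 !inE [spoke u == e]eq_sym eu ug mul1r.
  by rewrite -/x dE // (negbTE xe) subn0 subrr.
rewrite (bigD1 (spoke u)) /=; last by rewrite ug set21.
rewrite (eq_bigr (fun=> P' - P)) => [|e /andP[/andP[eg xe] eu]]; last first.
  rewrite /charge /potential1 !inE [spoke u == e]eq_sym (negbTE eu) ug mul1r.
  by rewrite -/x dE // xe subn1.
rewrite sumr_const /charge eqxx fD /potential1 setD11 mulr0 addr0 mulr1.
have -> : #|[pred e | (e \in g) && (x \in e) & e != spoke u]| = D.-1.
  have xu : x \in spoke u by apply: set21.
  rewrite /D /deg (cardsD1 (spoke u)) in_set ug xu /=.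
  by apply: eq_card => e; rewrite !inE andbC.
rewrite /P /P' /miss_ratio.
have [n DE] : exists n, D = (f x + n).+1 by exists (D - f x).-1; lia.
have -> : (D - f x = n.+1)%N by lia.
have -> : (D.-1 - f x = n)%N by lia.
have -> : (D.-1 = f x + n)%N by lia.
have -> : D%:R = (f x)%:R + n%:R + 1 :> R by rewrite DE -natr1 natrD.
rewrite -[X in _ + X]mulr_natl natrD -natr1.
have f0R : 0 < (f x)%:R :> R by rewrite ltr0n.
have n0R : 0 <= n%:R :> R by [].
rewrite le_eqVlt; apply/orP; left; apply/eqP; field.
by rewrite !gt_eqF ?ltr_wpDr ?addr_ge0 // ltW.
Qed.

Definition is_spoke x e := [exists u in L, (mid u == x) && (spoke u == e)].

Definition nspokes x g := #|[set e in g | is_spoke x e]|.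

(* A factor with exponent [nspokes x g] alone would not give a supermartingale
   when edges join two vertices of [N]. *)
Definition star_potential x g : R :=
  (1 + kappa * miss_ratio R (f x) (deg g x)) ^+ (nspokes x g).+1.

Definition potential g : R := \prod_(x in N) star_potential x g.

Lemma is_spokeP x e : reflect (exists u, [/\ u \in L, mid u = x & spoke u = e]) (is_spoke x e).
Proof.
apply: (iffP exists_inP) => [[u uL /andP[/eqP ? /eqP ?]]|[u [uL ux ue]]]; exists u => //.
by rewrite ux ue !eqxx.
Qed.

Lemma is_spoke_mem x e : is_spoke x e -> x \in e.
Proof. by case/is_spokeP => u [_ <- <-]; apply: set21. Qed.

Lemma nspokesD1 x g e : e \in g -> nspokes x g = (is_spoke x e + nspokes x (g :\ e))%N.
Proof.
move=> eg; rewrite /nspokes (cardsD1 e) !inE eg /=; congr (_ + _)%N.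
by apply: eq_card => a; rewrite !inE andbA.
Qed.

Lemma nspokes_le_deg x g : (nspokes x g <= deg g x)%N.
Proof.
apply/subset_leq_card/subsetP => e; rewrite !inE => /andP[-> /is_spoke_mem ->] //.
Qed.

Lemma star_base_ge1 x g : 1 <= 1 + kappa * miss_ratio R (f x) (deg g x).
Proof. by rewrite lerDl mulr_ge0 ?miss_ratio_ge0. Qed.

Lemma star_potential_gt0 x g : 0 < star_potential x g.
Proof. by rewrite exprn_gt0 // (lt_le_trans ltr01) ?star_base_ge1. Qed.

Let ratio g x e := star_potential x (g :\ e) / star_potential x g.

(* For non-spokes, [(r^2 - 1) / 2] bounds [r - 1], and sums to a bound for
   [r r' - 1] when both endpoints of [e] lie in [N]. *)
Let tau g x e : R :=
  if is_spoke x e then (if (f x < deg g x)%N then 1 + kappa else 1) * ratio g x e - 1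
  else (ratio g x e ^+ 2 - 1) / 2.

(** The spokes at [x] give the first term of [star_ineq] and the other edges at [x] the second. Once
    the degree is at most [f x], all ratios are 1 and every term vanishes. *)
Lemma sum_tau_le0 g x : x \in N -> \sum_(e in g | x \in e) tau g x e <= 0.
Proof.
move=> xN; have f0 := f_gt0 xN.
have [Df|fD] := leqP (deg g x) (f x).
  rewrite big1 // => e /andP[eg xe]; rewrite /tau /ratio ltnNge Df mul1r.
  have D'f : (deg (g :\ e) x <= f x)%N.
    by apply: leq_trans Df; rewrite (degD1 _ eg) leq_addl.
  rewrite /star_potential !miss_ratio0 // mulr0 addr0 !expr1n divr1 expr1n subrr.
  by rewrite mul0r if_same.
set D := deg g x in fD *; set a := nspokes x g.
have aD : (a <= D)%N by apply: nspokes_le_deg.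
have := star_ineq kappa_ge0 (introT andP (conj f0 fD)) aD.
set P := 1 + _ * miss_ratio R (f x) D; set P' := 1 + _ * _ => /=.
have dE e : e \in g -> x \in e -> deg (g :\ e) x = D.-1.
  by move=> eg xe; rewrite /D (degD1 x eg) xe.
have card_spokes : #|[pred e | (e \in g) && (x \in e) & is_spoke x e]| = a.
  apply: eq_card => e; rewrite !inE -andbA.
  by case: (boolP (is_spoke x e)) => [/is_spoke_mem ->|]; rewrite ?andbF.
apply: le_trans; rewrite (bigID (is_spoke x)) /=; apply: lerD.
  rewrite (eq_bigr (fun=> (1 + kappa) * P' ^+ a / P ^+ a.+1 - 1)).
    by rewrite sumr_const card_spokes mulr_natl.
  move=> e /andP[/andP[eg xe] se]; rewrite /tau se fD /ratio /star_potential.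
  have aE : (nspokes x (g :\ e)).+1 = a by rewrite /a (nspokesD1 x eg) se.
  by rewrite dE // aE mulrA.
rewrite (eq_bigr (fun=> ((P' ^+ a.+1 / P ^+ a.+1) ^+ 2 - 1) / 2)).
  rewrite sumr_const -[X in X <= _]mulr_natl mulrA.
  have -> // : #|[pred e | (e \in g) && (x \in e) & ~~ is_spoke x e]| = (D - a)%N.
  rewrite -card_spokes /D /deg -sum1dep_card -!sum1_card.
  by rewrite [X in (X - _)%N](bigID (is_spoke x)) /= addKn.
move=> e /andP[/andP[eg xe] /negbTE se]; rewrite /tau se /ratio /star_potential.
have aE : nspokes x (g :\ e) = a by rewrite /a (nspokesD1 x eg) se.
by rewrite dE // aE.
Qed.

Definition total_charge g e : R := \prod_(u in L) charge u g e.

(** Removing [e] changes only the factors of its endpoints in [N]. The spoke of [u] has just one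
    such endpoint, as [u] lies outside [N], and equality holds. Any other edge has charge 1 and at
    most two such endpoints, so [prod_le_half_sum_sqr] applies. *)
Lemma total_charge_le g e :
  #|e| = 2%N -> e \in g ->
  total_charge g e * potential (g :\ e) <=
  potential g * (1 + \sum_(x in N | x \in e) tau g x e).
Proof.
move=> e2 eg.
have ratio_notin x : x \notin e -> ratio g x e = 1.
  move=> xe; rewrite /ratio /star_potential (degD1 _ eg) (negbTE xe) add0n.
  rewrite (nspokesD1 _ eg); have -> : is_spoke x e = false.
    by apply: contraNF xe => /is_spoke_mem.
  by rewrite divff // gt_eqF // star_potential_gt0.
have -> : potential (g :\ e) = potential g * \prod_(x in N | x \in e) ratio g x e.
  rewrite /potential [X in _ * X](_ : _ = \prod_(x in N) ratio g x e).
    rewrite -big_split /=; apply: eq_bigr => x _.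
    by rewrite /ratio mulrC divfK // gt_eqF // star_potential_gt0.
  rewrite [RHS](bigID (fun x => x \in e)) /= [X in _ * X]big1 ?mulr1 //.
  by move=> x /andP[_ /ratio_notin].
rewrite mulrCA ler_pM2l; last by apply: prodr_gt0 => x _; apply: star_potential_gt0.
have [/existsP[u /andP[uL /eqP eu]]|/existsPn noA] := boolP [exists u, (u \in L) && (e == spoke u)].
  have NE x : (x \in N) && (x \in e) = (x == mid u).
    apply/andP/eqP => [[xN]|->]; last by rewrite eu set21 mid_in.
    rewrite eu => /set2P[//|xu]; rewrite xu in xN.
    by have := LN0 uL; rewrite xN.
  rewrite !(eq_bigl _ _ NE) !big_pred1_eq /tau.
  have -> : is_spoke (mid u) e by apply/is_spokeP; exists u.
  rewrite addrC subrK /total_charge (bigD1 u) //= big1 ?mulr1 => [|u' /andP[uL' uu']].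
    by rewrite /charge eu eqxx.
  rewrite /charge; case: eqP => //= eu'.
  have : u' \in e by rewrite eu' set22.
  rewrite eu => /set2P[um|/eqP]; last by rewrite (negbTE uu').
  by have := LN0 uL'; rewrite um mid_in.
have -> : total_charge g e = 1.
  rewrite /total_charge big1 // => u uL; rewrite /charge.
  by have := noA u; rewrite uL => /= /negbTE->.
rewrite mul1r [X in 1 + X](eq_bigr (fun x => (ratio g x e ^+ 2 - 1) / 2)) => [|x _].
  have := @prod_le_half_sum_sqr R V (N :&: e) (fun x => ratio g x e).
  rewrite !(eq_bigl _ _ (fun x => in_setI x N e)); apply.
  by rewrite -e2 subset_leq_card // subsetIr.
rewrite /tau; case: is_spokeP => // -[u [uL _ ue]].
by have := noA u; rewrite uL ue eqxx.
Qed.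

Lemma potential_super g :
  (forall e, e \in g -> #|e| = 2%N) ->
  \sum_(e in g) total_charge g e * potential (g :\ e) <= #|g|%:R * potential g.
Proof.
move=> g2.
apply: (@le_trans _ _ (\sum_(e in g) potential g * (1 + \sum_(x in N | x \in e) tau g x e))).
  by apply: ler_sum => e eg; apply: total_charge_le => //; apply: g2.
rewrite -mulr_sumr mulrC ler_wpM2r //.
  by apply: prodr_ge0 => x _; apply/ltW/star_potential_gt0.
rewrite big_split /= sumr_const gerDl.
rewrite (exchange_big_dep (mem N)) /= => [|e x _ /andP[]//].
apply: sumr_le0 => x xN; apply: le_trans (sum_tau_le0 g xN).
by rewrite le_eqVlt; apply/orP; left; apply/eqP; apply: eq_bigl => e; rewrite xN.
Qed.

End Potentials.

(** * Mean and exponential moments of the number of misses *)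

Section Misses.
Variables (R : realType) (V : finType) (E : {set {set V}}) (k : nat).
Variables (t : nat) (w0 : outcome E k) (eps : R).
Variables (N L : {set V}) (mid : V -> V) (f : V -> nat).
Hypothesis tE : (t <= #|E|)%N.
Hypothesis simpleE : simple_graph E.
Hypothesis mid_in : forall u, u \in L -> mid u \in N.
Hypothesis LN0 : forall u, u \in L -> u \notin N.
Hypothesis f_gt0 : forall x, x \in N -> (0 < f x)%N.

Let H := graph_at t w0.

Hypothesis eps01 : 0 <= eps < 1.
Hypothesis f_ratio : forall x, x \in N -> miss_ratio R (f x) (deg H x) <= eps.

Definition missed u (w : outcome E k) := [exists j : 'I_#|E|,
  [&& (j < t)%N, edge_at w j == spoke mid u
    & (f (mid u) < deg (graph_at j.+1 w) (mid u))%N]].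

Lemma charge_ge1 kappa u g e : 0 <= kappa -> 1 <= charge mid f kappa u g e :> R.
Proof. by move=> k0; rewrite /charge; case: ifP => // _; rewrite lerDl. Qed.

Lemma missed_charge kappa u w : 0 <= kappa ->
  (1 + kappa * (missed u w)%:R) <=
  \prod_(j < #|E| | (j < t)%N)
     charge mid f kappa u (graph_at j.+1 w) (edge_at w j) :> R.
Proof.
move=> k0; have ge1 j := charge_ge1 u (graph_at j.+1 w) _ k0.
case: (boolP (missed u w)) => [/existsP[j /and3P[jt je jf]]|_]; last first.
  by rewrite mulr0 addr0; elim/big_ind: _ => // *; apply: mulr_ege1.
rewrite mulr1 (bigD1 j) //= {1}/charge je jf /=.
apply: ler_peMr; first by rewrite addr_ge0.
by elim/big_ind: _ => // *; apply: mulr_ege1.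
Qed.

Let cnt := #|[set w : outcome E k | graph_at t w == H]|%:R : R.

(** The potential of a single vertex with [kappa = 1] bounds the mean of [1 + missed] by
    [1 + eps]. *)
Lemma sum_missed_le u : u \in L ->
  \sum_(w : outcome E k | graph_at t w == H) (missed u w)%:R <= cnt * eps.
Proof.
move=> uL; have k0 : 0 <= 1 :> R := ler01.
have := random_order_bound tE (fun g e => le_trans ler01 (charge_ge1 u g e k0))
  (fun g _ => @potential1_super R V N L mid f 1 k0 mid_in f_gt0 u g uL).
move=> /(_ k w0).
have -> : potential1 mid f 1 u set0 = 1 :> R.
  by rewrite /potential1 inE mulr0 addr0.
under eq_bigr do rewrite mulr1.
have : cnt * potential1 mid f 1 u H <= cnt * (1 + eps).
  apply: ler_wpM2l => //; rewrite lerD2l mul1r; case: ifP => _; first exact: f_ratio (mid_in uL).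
  by case/andP: eps01.
move=> h2 h1; have := le_trans h1 h2.
have : \sum_(w : outcome E k | graph_at t w == H) (1 + (missed u w)%:R) <=
       \sum_(w : outcome E k | graph_at t w == H) \prod_(j < #|E| | (j < t)%N)
          charge mid f 1 u (graph_at j.+1 w) (edge_at w j) :> R.
  by apply: ler_sum => w _; have := missed_charge u w k0; rewrite mul1r.
move=> h3 h4; have := le_trans h3 h4.
by rewrite big_split /= sumr_const -cardsE mulrDr mulr1 lerD2l.
Qed.

Definition nmissed w := (\sum_(u in L) missed u w)%N.

(** Every base is at most [1 + kappa * eps]. In the exponents, each vertex of [L] has a single
    midpoint, so the spokes number at most [#|L|]; the extra 1 at each centre adds [#|N|]. *)
Lemma potential_le kappa : 0 <= kappa ->
  potential N L mid f kappa H <= (1 + kappa * eps) ^+ (#|L| + #|N|) :> R.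
Proof.
move=> k0.
have base1 : 1 <= 1 + kappa * eps by rewrite lerDl mulr_ge0 //; case/andP: eps01.
apply: (@le_trans _ _ (\prod_(x in N) (1 + kappa * eps) ^+ (nspokes L mid x H).+1)).
  apply: ler_prod => x xN; rewrite ltW ?star_potential_gt0 //=.
  rewrite /star_potential lerXn2r ?nnegrE //.
  - by apply: (le_trans ler01); apply: star_base_ge1.
  - exact: le_trans ler01 base1.
  - by rewrite lerD2l ler_wpM2l // f_ratio.
rewrite prodrXr; apply: ler_weXn2l => //.
under eq_bigr do rewrite -addn1.
rewrite big_split /= sum1_card leq_add2r.
apply: (@leq_trans (\sum_(x in N) #|[set u in L | mid u == x]|)).
  apply: leq_sum => x _; apply: leq_trans (leq_imset_card (spoke mid) _).
  apply/subset_leq_card/subsetP => e; rewrite inE => /andP[_ /is_spokeP[u [uL ux <-]]].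
  by apply: imset_f; rewrite inE uL ux eqxx.
rewrite -[X in (_ <= X)%N]sum1_card [X in (_ <= X)%N](partition_big mid (mem N)) //=.
by apply: leq_sum => x _; rewrite sum1dep_card.
Qed.

Lemma missed_mgf (lambda : R) : 0 <= lambda ->
  \sum_(w : outcome E k | graph_at t w == H) expR (lambda * (nmissed w)%:R) <=
  cnt * expR (lambda * (eps * #|L|%:R + #|N|%:R) + lambda ^+ 2 * #|L|%:R / 8).
Proof.
move=> l0; pose kappa := expR lambda - 1.
have k0 : 0 <= kappa by rewrite subr_ge0 -expR0 ler_expR.
have c0 g e : 0 <= total_charge L mid f kappa g e.
  by apply: prodr_ge0 => u _; apply: le_trans ler01 (charge_ge1 _ _ _ k0).
have superm (g : {set {set V}}) : g \subset graph_at t w0 ->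
   \sum_(e in g) total_charge L mid f kappa g e * potential N L mid f kappa (g :\ e)
     <= #|g|%:R * potential N L mid f kappa g.
  move=> gH; apply: potential_super => // e eg; apply: simpleE.
  exact: (subsetP (subset_trans gH (graph_at_sub _ _))).
have := random_order_bound tE c0 superm.
have -> : potential N L mid f kappa set0 = 1.
  by rewrite /potential big1 // => x _; rewrite /star_potential deg0 miss_ratio0 // mulr0 addr0 expr1n.
under eq_bigr do rewrite mulr1.
move=> h1; apply: le_trans (le_trans h1 _).
  apply: ler_sum => w _; rewrite exchange_big /= /nmissed natr_sum mulr_sumr expR_sum.
  apply: ler_prod => u _; rewrite expR_ge0 /=.
  apply: le_trans (missed_charge u w k0); rewrite /kappa.
  by case: (missed u w); rewrite ?mulr1 ?mulr0 ?expR0 ?addr0 // addrC subrK.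
apply: ler_wpM2l => //; apply: le_trans (potential_le k0) _.
have [e0 e1] := andP eps01.
have base0 : 0 <= 1 + kappa * eps by rewrite addr_ge0 // mulr_ge0.
rewrite exprD.
have -> : lambda * (eps * #|L|%:R + #|N|%:R) + lambda ^+ 2 * #|L|%:R / 8 =
  #|L|%:R * (eps * lambda + lambda ^+ 2 / 8) + #|N|%:R * lambda by ring.
(* The [#|L|] factors are bounded by [bernoulli_mgf_le], the [#|N|] extra ones crudely by
   [expR lambda]. *)
rewrite expRD !expRM_natl ler_pM ?exprn_ge0 // lerXn2r ?nnegrE ?expR_ge0 //.
  by rewrite mulrC; apply: bernoulli_mgf_le.
by rewrite -[X in _ <= X](subrKC 1) -/kappa lerD2l ler_piMr // ltW.
Qed.

End Misses.

(** * Conditioning on the graph formed by the first [t] edges *)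

Section Conditioned.
Variables (R : realType) (eps : R) (V : finType) (E : {set {set V}}).
Variables (orient : {set V} -> V * V) (t k : nat).
Hypothesis eps01 : 0 < eps < 1.
Hypothesis simpleE : simple_graph E.
Hypothesis orientE : orientation E orient.
Hypothesis tE : (t <= #|E|)%N.
Variables (w0 : outcome E k) (v : V).

Let phi := eps / (1 - eps).
Let H := graph_at t w0.
Let N := nbhd H v.
Let L := layer2 H v.

Definition seen_count x := (counters phi (deg H x)).1.

(** The choice is made from [H] alone, so one midpoint serves all outcomes whose first [t] edges
    form [H]. *)
Definition midpoint u := odflt u [pick x | adj H v x && adj H x u].

Lemma midpointP u : u \in L -> adj H v (midpoint u) && adj H (midpoint u) u.
Proof.
rewrite /L layer2E inE in_ball2 => /andP[/negbTE->] /existsP[x xP].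
by rewrite /midpoint; case: pickP => [y //|/(_ x)]; rewrite xP.
Qed.

Lemma midpoint_in u : u \in L -> midpoint u \in N.
Proof. by case/midpointP/andP; rewrite inE. Qed.

Lemma layer2_notin u : u \in L -> u \notin N.
Proof. by rewrite /L layer2E inE in_ball1 => /andP[/norP[_ ?] _]; rewrite inE. Qed.

Lemma phi_ge0 : 0 <= phi.
Proof. by case/andP: eps01 => e0 e1; apply: divr_ge0; rewrite ?subr_ge0 ltW. Qed.

Lemma deg_gt0 x : x \in N -> (0 < deg H x)%N.
Proof.
rewrite inE => vx; apply/card_gt0P; exists [set v; x].
by rewrite inE set22 andbT.
Qed.

(** The degree is [Delta + delta] with [delta <= phi * Delta], and [1 + phi] is the inverse of
    [1 - eps]. *)
Lemma seen_count_ge x : (1 - eps) * (deg H x)%:R <= (seen_count x)%:R.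
Proof.
have := counters_ratio (deg H x) phi_ge0.
rewrite -[X in _ -> _ * X%:R <= _](counters_add phi) natrD -/(seen_count x).
move: (counters phi _).2%:R (seen_count x)%:R => b a ba.
have [e0 e1] := andP eps01; have e1' : 0 < 1 - eps by rewrite subr_gt0.
move: ba; rewrite /phi mulrAC ler_pdivlMr //; lra.
Qed.

Lemma seen_count_gt0 x : x \in N -> (0 < seen_count x)%N.
Proof.
move=> /deg_gt0 d0; rewrite -(ltr0n R); apply: lt_le_trans (seen_count_ge x).
by rewrite mulr_gt0 ?ltr0n // subr_gt0; case/andP: eps01.
Qed.

Lemma seen_count_ratio x : x \in N -> miss_ratio R (seen_count x) (deg H x) <= eps.
Proof.
move=> /deg_gt0 d0; rewrite /miss_ratio ler_pdivrMr ?ltr0n //.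
rewrite natrB ?counters_le //; have := seen_count_ge x; lra.
Qed.

Lemma seen_of_not_missed u (w : outcome E k) : graph_at t w = H -> u \in L ->
  ~~ missed t midpoint seen_count u w ->
  u \in tB2 (lazy_alg orient phi t w) v.
Proof.
move=> wH uL nm; have /andP[vm mu] := midpointP uL.
have : [set midpoint u; u] \in graph_at t w by rewrite wH.
case/imsetP => j; rewrite inE => jt /esym ej.
apply: (lazy_alg_seen simpleE orientE tE jt ej); last by rewrite wH.
rewrite wH leqNgt; apply: contra nm => lt; apply/existsP; exists j.
by rewrite jt ej eqxx lt.
Qed.

(** The approximate ball together with the missed vertices covers the disjoint union of [ball1 H v]
    and [L]. Keeping the whole of [ball1 H v] in the count leaves room for the [#|N|] excess misses
    in the tail bound. *)
Lemma card_tB2_ge (w : outcome E k) : graph_at t w = H ->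
  (#|ball1 H v| + #|L| <=
   #|tB2 (lazy_alg orient phi t w) v| + nmissed t L midpoint seen_count w)%N.
Proof.
move=> wH; set B := tB2 _ v.
have B1 : ball1 H v \subset B.
  rewrite -wH; exact: inv_tB2_sup (lazy_alg_invariant phi simpleE orientE w tE) v.
pose M := [set u in L | missed t midpoint seen_count u w].
have -> : nmissed t L midpoint seen_count w = #|M|.
  by rewrite /nmissed big_mkcond -sum1dep_card [RHS]big_mkcond; apply: eq_bigr => u _;
    case: (u \in L) => //=; case: missed.
have dis : ball1 H v :&: L = set0.
  by apply/setP => u; rewrite /L layer2E !inE; case: (u == v) => //=; case: adj.
rewrite -cardsUI dis cards0 addn0.
apply: leq_trans (leq_card_setU B M); apply/subset_leq_card.
rewrite subUset (subset_trans B1 (subsetUl _ _)) /=.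
apply/subsetP => u uL; rewrite inE orbC inE uL /=.
by case: (boolP (missed _ _ _ _ _)) => //= nm; apply: seen_of_not_missed.
Qed.

Lemma card_ball2 : #|ball2 H v| = (#|ball1 H v| + #|L|)%N.
Proof.
by rewrite /L layer2E -[LHS](cardsID (ball1 H v)) (setIidPr (ball1_sub_ball2 _ _)).
Qed.

Let cnt := #|[set w : outcome E k | graph_at t w == H]|%:R : R.

Lemma cnt_gt0 : 0 < cnt.
Proof. by rewrite ltr0n; apply/card_gt0P; exists w0; rewrite inE. Qed.

Lemma sum_cnt (a : R) : \sum_(w : outcome E k | graph_at t w == H) a = cnt * a.
Proof. by rewrite sumr_const mulr_natl /cnt cardsE. Qed.

(** By linearity at most [eps * #|L|] vertices are missed on average; the 1-ball is never missed,
    which leaves a slack of [eps] times its size. *)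
Lemma expected_card_ge :
  (1 - eps) * #|ball2 H v|%:R <=
  cond_expect (@graph_at V E k t)
    (fun w => #|tB2 (lazy_alg orient phi t w) v|%:R) w0.
Proof.
have [e0 e1] := andP eps01.
rewrite /cond_expect -/H ler_pdivlMr ?cnt_gt0 // -/cnt.
have misses : \sum_(w : outcome E k | graph_at t w == H)
    (nmissed t L midpoint seen_count w)%:R <= cnt * eps * #|L|%:R.
  under eq_bigr do rewrite /nmissed natr_sum.
  rewrite exchange_big /= mulr_natr -sumr_const; apply: ler_sum => u uL.
  apply: (@sum_missed_le R V E k t w0 eps N L) => //.
  - exact: midpoint_in.
  - exact: seen_count_gt0.
  - by rewrite ltW.
  - exact: seen_count_ratio.
have : \sum_(w : outcome E k | graph_at t w == H) (#|ball1 H v| + #|L|)%:R <=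
   \sum_(w : outcome E k | graph_at t w == H) (#|tB2 (lazy_alg orient phi t w) v|%:R
     + (nmissed t L midpoint seen_count w)%:R) :> R.
  by apply: ler_sum => w /eqP wH; rewrite -natrD ler_nat; apply: card_tB2_ge.
rewrite big_split /= sum_cnt card_ball2 !natrD.
have c0 := cnt_gt0; have b0 : 0 <= #|ball1 H v|%:R :> R by [].
have := mulr_ge0 (mulr_ge0 (ltW c0) b0) (ltW e0).
move: misses; set S := \sum_(w | _) _; set S' := \sum_(w | _) _.
move: cnt #|ball1 H v|%:R #|L|%:R => c b l *; lra.
Qed.

Lemma lower_tail_le (alpha : R) : 0 < alpha ->
  cond_prob R (@graph_at V E k t)
    (fun w => #|tB2 (lazy_alg orient phi t w) v|%:R
                < (1 - alpha) / (1 + phi) * #|layer2 (graph_at t w) v|%:R) w0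
  <= expR (- (2 * alpha ^+ 2 * #|layer2 H v|%:R / (1 + phi) ^+ 2)).
Proof.
move=> alpha0; have [e0 e1] := andP eps01.
have phiE : (1 + phi)^-1 = 1 - eps by rewrite /phi; field; lra.
rewrite /cond_prob -/H -/L -/cnt ler_pdivrMr ?cnt_gt0 //.
rewrite phiE -exprVn phiE.
(* The minimiser of [lambda ^+ 2 / 8 - lambda * alpha * (1 - eps)], the Chernoff exponent per vertex
   of [L]. *)
pose lambda : R := 4 * alpha * (1 - eps).
have l0 : 0 <= lambda by rewrite /lambda; nra.
pose X (w : outcome E k) := expR (lambda * (nmissed t L midpoint seen_count w)%:R).
(* Markov threshold: by [card_tB2_ge], on the tail event the misses exceed [eps * #|L| + #|N|] by at
   least [alpha * (1 - eps) * #|L|]. *)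
pose c := expR (lambda * (eps * #|L|%:R + #|N|%:R + alpha * (1 - eps) * #|L|%:R)).
have mgf : \sum_(w : outcome E k | graph_at t w == H) X w <=
  cnt * expR (lambda * (eps * #|L|%:R + #|N|%:R) + lambda ^+ 2 * #|L|%:R / 8).
  apply: missed_mgf => //.
  - exact: midpoint_in.
  - exact: layer2_notin.
  - exact: seen_count_gt0.
  - by rewrite ltW.
  - exact: seen_count_ratio.
set A := [set w | _].
have markov : #|A|%:R * c <= \sum_(w : outcome E k | graph_at t w == H) X w.
  rewrite mulr_natl -sumr_const /A big_mkcond [X in _ <= X]big_mkcond.
  apply: ler_sum => w _; rewrite inE; case: eqP => [wH|_] //=.
  case: ifP => [small|_]; last exact: expR_ge0.
  rewrite /c /X ler_expR ler_wpM2l //.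
  have := card_tB2_ge wH; rewrite -(ler_nat R) !natrD.
  have : #|N|%:R <= #|ball1 H v|%:R :> R.
    by rewrite ler_nat subset_leq_card // subsetUr.
  by move: small; rewrite wH -/L; lra.
rewrite -(ler_pM2r (expR_gt0 _ : 0 < c)).
apply: (le_trans markov); apply: (le_trans mgf).
rewrite /c [leRHS]mulrAC -expRD mulrC ler_pM2r ?cnt_gt0 // ler_expR.
by rewrite /lambda le_eqVlt; apply/orP; left; apply/eqP; field.
Qed.

End Conditioned.

Theorem theorem3p3 (R : realType) (eps : R) (V : finType) (E : {set {set V}})
    (orient : {set V} -> V * V) (t : nat) :
  0 < eps < 1 ->
  simple_graph E ->
  orientation E orient ->
  (t <= #|E|)%N ->
  let k := 0%N in
  let phi := eps / (1 - eps) in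
  let G := @graph_at V E k t in
  let apxB2 (w : outcome E k) (v : V) := tB2 (lazy_alg orient phi t w) v in
  [/\ forall (w : outcome E k) (v : V), apxB2 w v \subset ball2 (G w) v,
      forall (w0 : outcome E k) (v : V),
        cond_expect G (fun w => #|apxB2 w v|%:R) w0
          >= (1 - eps) * #|ball2 (G w0) v|%:R
    & forall (alpha : R) (v : V) (w0 : outcome E k), 0 < alpha ->
        cond_prob R G
          (fun w => #|apxB2 w v|%:R
                      < (1 - alpha) / (1 + phi) * #|layer2 (G w) v|%:R) w0
          <= expR (- (2 * alpha ^+ 2 * #|layer2 (G w0) v|%:R
                        / (1 + phi) ^+ 2))].
Proof.
move=> eps01 simpleE orientE tE k phi G apxB2; split.
- move=> w v; exact: inv_tB2_sub (lazy_alg_invariant phi simpleE orientE w tE) v.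
- by move=> w0 v; apply: expected_card_ge.
- by move=> alpha v w0; apply: lower_tail_le.
Qed.
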